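(* Let $E\subset\mathbb{R}^d$, $\mu$, $A$, $B$ and $(\overline{T}_t)_{t>0}$ be as in the context. If $(\overline{T}_t)_{t>0}$ is recurrent, then it is conservative.
   Context: Setting. $E\subset\mathbb{R}^d$ is either open or closed; if $E$ is closed, $dx(\partial E)=0$. $\varphi\in L^1_{loc}(E,dx)$, $\varphi>0$ $dx$-a.e., and $d\mu:=\varphi\,dx$, a $\sigma$-finite measure on $\mathcal{B}(E)$ with full support. $C_0^\infty(E)$ is the set of smooth functions with compact support in $E$ if $E$ is open, and the set of restrictions to $E$ of functions in $C_0^\infty(\mathbb{R}^d)$ if $E$ is closed. $\langle\cdot,\cdot\rangle$ and $|\cdot|$ are the Euclidean inner product and norm. $V\subset\subset E$ means $V$ is relatively open in $E$ with compact closure contained in $E$. $A=(a_{ij})_{1\le i,j\le d}$ with $a_{ij}\in L^1_{loc}(E,\mu)$ is a possibly non-symmetric matrix with symmetric part $\tilde a_{ij}=\frac12(a_{ij}+a_{ji})$, and for each $V\subset\subset E$ there is $\nu_V>0$ with $\nu_V^{-1}|\xi|^2\le\sum_{i,j}\tilde a_{ij}(x)\xi_i\xi_j\le\nu_V|\xi|^2$ for all $\xi\in\mathbb{R}^d$, $x\in V$. The form $\mathcal{E}^0(f,g):=\int_E\langle A\nabla f,\nabla g\rangle\,d\mu$, $f,g\in C_0^\infty(E)$, is assumed closable on $L^2(E,\mu)$ and to satisfy the strong sector condition $|\mathcal{E}^0(f,g)|\le K\mathcal{E}^0(f,f)^{1/2}\mathcal{E}^0(g,g)^{1/2}$ for some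 $K>0$; its closure is $(\mathcal{E}^0,D(\mathcal{E}^0))$, with generator $(L^0,D(L^0))$. $\nabla$ is the weak gradient, extended to $D(\mathcal{E}^0)$ as $L^2_{loc}(E,\mathbb{R}^d,\mu)$-limit along $\mathcal{E}^0_1$-approximating sequences in $C_0^\infty(E)$. For $V\subset\subset E$, $C_0^\infty(V):=\{u\in C_0^\infty(E):\mathrm{supp}(u)\subset V\}$, $(\mathcal{E}^{0,V},D(\mathcal{E}^{0,V}))$ is the closure of $(\mathcal{E}^0,C_0^\infty(V))$ on $L^2(V,\mu)$, and $D(\mathcal{E}^{0,E}):=\bigcup_{V\subset\subset E}D(\mathcal{E}^{0,V})\subset D(\mathcal{E}^0)$. For a function space $W$: $W_b$ is the set of $\mu$-a.e. bounded elements, $W_0$ the set of elements with compact support in $E$ (support of $|u|d\mu$), $W_{0,b}=W_0\cap W_b$. $B=(B_1,\dots,B_d)\in L^2_{loc}(E,\mathbb{R}^d,\mu)$ is $\mu$-divergence free: $\int_E\langle B,\nabla f\rangle\,d\mu=0$ for all $f\in C_0^\infty(E)$. It is assumed that $D(L^0)_{0,b}$ is a dense subset of $L^1(E,\mu)$. The operator $\overline{L}$. For $V\subset\subset E$ let $(L^{0,V},D(L^{0,V}))$ be the generator of $(\mathcal{E}^{0,V},D(\mathcal{E}^{0,V}))$ on $L^2(V,\mu)$. The operator $L^Vu:=L^{0,V}u+\langle B,\nabla u\rangle$, $u\in D(L^{0,V})_b$, is closable on $L^1(V,\mu)$ and its closure $\overline{L}^V$ generates a sub-Markovian $C_0$-resolvent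 of contractions $(\overline{G}^V_\alpha)_{\alpha>0}$. For open $V_n\subset\subset E$ with $\overline{V}_n\subset V_{n+1}$, $\bigcup_nV_n=E$, and $f\in L^1(E,\mu)$, the limit $\overline{G}_\alpha f:=\lim_{n\to\infty}\overline{G}^{V_n}_\alpha(f1_{V_n})$ exists $\mu$-a.e., is independent of the choice of $(V_n)$, and $(\overline{G}_\alpha)_{\alpha>0}$ is a sub-Markovian $C_0$-resolvent of contractions on $L^1(E,\mu)$. $(\overline{L},D(\overline{L}))$ is its generator and $(\overline{T}_t)_{t>0}$ the corresponding sub-Markovian $C_0$-semigroup of contractions on $L^1(E,\mu)$. $(\overline L,D(\overline L))$ extends $L^0u+\langle B,\nabla u\rangle$, $u\in D(L^0)_{0,b}$; moreover $D(\overline{L})_b\subset D(\mathcal{E}^0)$, and for $u\in D(\overline{L})_b$, $v\in D(\mathcal{E}^{0,E})_b$, $\mathcal{E}^0(u,v)-\int_E\langle B,\nabla u\rangle v\,d\mu=-\int_E\overline{L}u\,v\,d\mu$ and $\mathcal{E}^0(u,u)\le-\int_E\overline{L}u\,u\,d\mu$. Recurrence and conservativeness. For $f\in L^1(E,\mu)$, $f\ge0$, $Gf:=\lim_{N\to\infty}\int_0^N\overline{T}_tf\,dt\in[0,\infty]$. $(\overline{T}_t)_{t>0}$ is recurrent if for every $f\in L^1(E,\mu)$ with $f\ge0$ $\mu$-a.e. one has $Gf(x)\in\{0,\infty\}$ for $\mu$-a.e. $x$. $\overline{T}_t$ extends to $L^\infty(E,\mu)$ by $\overline{T}_tf:=\lim_n\overline{T}_tf_n$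 $\mu$-a.e. for $f\ge0$ and any increasing sequence of nonnegative bounded $f_n\in L^1(E,\mu)$ with $f_n\nearrow f$. $(\overline{T}_t)_{t>0}$ is conservative if for some (and hence any) $t>0$, $\overline{T}_t1=1$ $\mu$-a.e. *)

(* Defs.v *)
From HB Require Import structures.
From mathcomp Require Import all_boot all_order all_algebra.
From mathcomp Require Import all_classical all_reals all_analysis measurable_realfun.
Set Implicit Arguments. Unset Strict Implicit. Unset Printing Implicit Defensive.
Import Order.TTheory GRing.Theory Num.Theory.
Import numFieldNormedType.Exports.
Local Open Scope classical_set_scope.
Local Open Scope ring_scope.

(* R^n is 'rV[R]_n.  The library norm on it is the sup norm, which induces the
   Euclidean topology, hence the usual Borel sets. *)
HB.instance Definition _ (R : realType) (n : nat) :=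
  @isMeasurable.Build (sigma_display (@open 'rV[R]_n)) 'rV[R]_n
    <<s @open 'rV[R]_n >> (@sigma_algebra0 _ setT _)
    (@sigma_algebraC _ _) (@sigma_algebra_bigcup _ setT _).

Section tuple_to_row.
Context {R : realType} {n : nat}.

Definition row_of_tuple (t : n.-tuple (measurableTypeR R)) : 'rV[R]_n := \row_i tnth t i.

Lemma open_countable_balls (O : set 'rV[R]_n) : open O ->
  O = \bigcup_(p in [set p : 'rV[rat]_n * rat |
      ball (map_mx ratr p.1 : 'rV[R]_n) (ratr p.2) `<=` O])
    ball (map_mx ratr p.1 : 'rV[R]_n) (ratr p.2).
Proof.
move=> oO; apply/seteqP; split=> [x Ox|x [p pO] /pO//].
have /nbhs_ballP[e /= e0 xeO] : nbhs x O by exact: open_nbhs_nbhs.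
have e20 : (0 < e / 2)%R by rewrite divr_gt0.
have [r] := rat_in_itvoo e20; rewrite in_itv/= => /andP[r0 re].
have /choice[q qP] : forall i, exists q : rat, ball (x ord0 i) (ratr r) (ratr q : R).
  move=> i; have [|q] := @rat_in_itvoo R (x ord0 i - ratr r) (x ord0 i + ratr r).
    by rewrite ltrBlDr -addrA ltrDl addr_gt0.
  by rewrite in_itv/= => h; exists q; rewrite /ball/= distrC ltr_distl.
have rx : ball (map_mx ratr (\row_i q i) : 'rV[R]_n) (ratr r) x.
  by split=> // i j; rewrite !mxE (ord1 i); exact/ball_sym.
exists (\row_i q i, r) => //= y qy; apply: xeO.
by apply: le_ball (ball_triangle (ball_sym rx) qy); rewrite (splitr e) lerD ?ltW.
Qed.

Lemma measurable_row_of_tuple : measurable_fun [set: n.-tuple (measurableTypeR R)] row_of_tuple.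
Proof.
apply: (@measurability _ _ _ _ _ _ (@open 'rV[R]_n)) ; first by [].
move=> B [U oU <-{B}].
rewrite setTI (open_countable_balls oU) preimage_bigcup bigcup_mkcond.
apply: countable_bigcupT_measurable => // p; case: ifP => [_|//].
have [p0|p0] := ltP (0 : R) (ratr p.2); last first.
  rewrite [X in measurable X](_ : _ = set0)// -subset0 => t [].
  by rewrite ltNge p0.
rewrite [X in measurable X](_ : _ = \bigcap_(i : 'I_n)
  ((@tnth _ _)^~ i @^-1` ball (ratr (p.1 ord0 i) : R) (ratr p.2))); last first.
  apply/seteqP; split=> t /=.
    by move=> [_ h] i _ /=; have := h ord0 i; rewrite !mxE.
  by move=> h; split => // i j; rewrite !mxE (ord1 i); exact: h.
apply: fin_bigcap_measurable => [|i _]; first exact: finite_finset.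
rewrite -[X in measurable X]setTI; apply: measurable_tnth => //.
exact: measurable_ball.
Qed.

HB.instance Definition _ :=
  isMeasurableFun.Build _ _ _ _ row_of_tuple measurable_row_of_tuple.

End tuple_to_row.


Section mpushforward.
Context d1 d2 (T1 : measurableType d1) (T2 : measurableType d2) (R : realType).
Variables (m : {measure set T1 -> \bar R}) (f : {mfun T1 >-> T2}).

Definition mpushforward : set T2 -> \bar R := pushforward m f.

Let mp0 : mpushforward set0 = 0%E. Proof. exact: measure0. Qed.
Let mp_ge0 U : (0 <= mpushforward U)%E. Proof. exact: measure_ge0. Qed.
Let mp_additive : semi_sigma_additive mpushforward.
Proof. exact: measure_semi_sigma_additive. Qed.

HB.instance Definition _ :=
  isMeasure.Build _ _ _ mpushforward mp0 mp_ge0 mp_additive.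
End mpushforward.

Lemma product_sigma_finite d1 d2 (T1 : measurableType d1)
    (T2 : measurableType d2) (R : realType)
    (m1 : {sigma_finite_measure set T1 -> \bar R})
    (m2 : {sigma_finite_measure set T2 -> \bar R}) :
  sigma_finite setT (m1 \x m2)%E.
Proof.
have /sigma_finiteP[F [TF ndF Foo]] := sigma_finiteT m1.
have /sigma_finiteP[G [TG ndG Goo]] := sigma_finiteT m2.
exists (fun n => F n `*` G n).
  rewrite -setXTT TF TG predeqE => -[x y]; split.
    move=> [/= [n _ Fnx] [k _ Gky]]; exists (maxn n k) => //; split.
    - by move: x Fnx; exact/subsetPset/ndF/leq_maxl.
    - by move: y Gky; exact/subsetPset/ndG/leq_maxr.
  by move=> [n _ []/= ? ?]; split; exists n.
move=> k; have [? ?] := Foo k; have [? ?] := Goo k.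
split; first exact: measurableX.
by rewrite product_measure1E// lte_mul_pinfty// ge0_fin_numE.
Qed.

Section lebesgue_tuple.
Context {R : realType}.

Definition cons_pair n (x : measurableTypeR R * n.-tuple (measurableTypeR R)) : n.+1.-tuple (measurableTypeR R) :=
  [tuple of x.1 :: x.2].

Let measurable_cons_pair n : measurable_fun setT (@cons_pair n).
Proof. exact: measurable_cons. Qed.

HB.instance Definition _ n :=
  isMeasurableFun.Build _ _ _ _ (@cons_pair n) (@measurable_cons_pair n).

Let leb : {sigma_finite_measure set (measurableTypeR R) -> \bar R} :=
  lebesgue_measure.

Section step.
Context n (m : {sigma_finite_measure set (n.-tuple (measurableTypeR R)) -> \bar R}).

Definition lebesgue_cons : set (n.+1.-tuple (measurableTypeR R)) -> \bar R :=
  mpushforward (leb \x m)%E (@cons_pair n).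

HB.instance Definition _ := Measure.on lebesgue_cons.

Let lebesgue_cons_sigma_finite : sigma_finite setT lebesgue_cons.
Proof.
have [F FT Foo] := product_sigma_finite leb m.
pose u (t : n.+1.-tuple (measurableTypeR R)) := (thead t, [tuple of behead t]).
have mu : measurable_fun setT u.
  by apply: measurable_fun_pair; [exact: measurable_tnth|exact: measurable_behead].
have uK x : u (cons_pair x) = x.
  by case: x => a b; congr pair => //; exact/val_inj.
exists (fun k => u @^-1` F k); first by rewrite -preimage_bigcup -FT preimage_setT.
move=> k; split; first by rewrite -[X in measurable X]setTI; apply: mu => //; case: (Foo k).
rewrite /lebesgue_cons /mpushforward /pushforward -comp_preimage.
rewrite (_ : u \o _ = id) ?preimage_id; [by case: (Foo k)|exact/funext].
Qed.

HB.instance Definition _ :=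
  @Measure_isSigmaFinite.Build _ _ _ lebesgue_cons lebesgue_cons_sigma_finite.
End step.

(* Lebesgue measure on R^n as an iterated product measure, first on tuples and
   then transported to row vectors. *)
Fixpoint lebesgue_tuple n : {sigma_finite_measure set (n.-tuple (measurableTypeR R)) -> \bar R} :=
  if n is k.+1 then lebesgue_cons (lebesgue_tuple k) else \d_([tuple of nil]).

Definition lebesgue_rV n : {measure set 'rV[R]_n -> \bar R} :=
  mpushforward (lebesgue_tuple n) row_of_tuple.

End lebesgue_tuple.

Section function_spaces.
Context {R : realType} {d : nat}.
Local Notation X := 'rV[R]_d.
Implicit Types (mu : {measure set X -> \bar R}) (D E K V : set X).
Implicit Types (f g u v h : X -> R) (w : X -> X).

(* Functions on a Borel set D (such as E, or V relatively compact in E) are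
   represented by total functions X -> R considered mu-a.e. on D. *)

Definition L1 mu D f := mu.-integrable D (EFin \o f).

Definition L2 mu D f :=
  measurable_fun D f /\ mu.-integrable D (fun x => (f x ^+ 2)%:E).

Definition L1loc mu E f := measurable_fun E f /\
  forall K, compact K -> K `<=` E -> L1 mu K f.

Definition L2loc mu E f := measurable_fun E f /\
  forall K, compact K -> K `<=` E -> L2 mu K f.

Definition L1dist mu D f g : \bar R := \int[mu]_(x in D) `|(f x - g x)%:E|.

Definition L1cvg mu D (un : nat -> X -> R) u :=
  L1dist mu D (un n) u @[n --> \oo] --> 0%E.

Definition L2cvg mu D (un : nat -> X -> R) u :=
  (\int[mu]_(x in D) ((un n x - u x) ^+ 2)%:E)%E @[n --> \oo] --> 0%E.

Definition ae_bounded mu D u :=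
  exists M : R, {ae mu, forall x, D x -> `|u x| <= M}.

(* Extension by zero outside V of a function on V; also f 1_V. *)
Definition zext V f : X -> R := fun x => f x * \1_V x.

Definition relcompact E V :=
  [/\ exists2 U : set X, open U & V = E `&` U,
      compact (closure V) & closure V `<=` E].

(* Support, relative to E, of a function on E. *)
Definition supp E u : set X := E `&` closure [set x | E x /\ u x != 0].

(* Support, relative to E, of the measure |u| dmu on E. *)
Definition msupp mu E u : set X := [set x | E x /\
  forall U : set X, open U -> U x ->
    (0 < \int[mu]_(y in E `&` U) `|(u y)%:E|)%E].

Definition dotv (v w : X) : R := \sum_i v ord0 i * w ord0 i.

Definition partial (i : 'I_d) f : X -> R := fun x => 'D_(delta_mx ord0 i) f x.

Definition grad f : X -> X := fun x => \row_i partial i f x.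

(* C^infinity: differentiability of every iterated partial derivative makes
   all of them continuous. *)
Definition smooth f :=
  forall (s : seq 'I_d) (x : X), differentiable (foldr partial f s) x.

(* C_0^infinity(E).  For open E an element is identified with its smooth
   extension by zero to R^d; for closed E it is the restriction to E of an
   element of C_0^infinity(R^d), represented here by the latter.  When the
   boundary of the closed set E is null, the gradient of the representative is
   a.e. determined on E by the restriction. *)
Definition C0inf E f :=
  [/\ smooth f, compact (closure [set x | f x != 0]) &
      open E -> closure [set x | f x != 0] `<=` E].

Definition C0inf_in E V f := C0inf E f /\ supp E f `<=` V.

End function_spaces.

Section form.
Context {R : realType} {d : nat}.
Local Notation X := 'rV[R]_d.
Variables (mu : {measure set X -> \bar R}) (E : set X) (A : X -> 'M[R]_d).
Implicit Types (D K V : set X) (core : set (X -> R)).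
Implicit Types (u v h : X -> R) (w : X -> X).

(* E^0(f, g) = \int_E <A grad f, grad g> dmu; vectors being rows, A v reads
   v *m A^T. *)
Definition dform u v : R :=
  \int[mu]_(x in E) dotv (grad u x *m (A x)^T) (grad v x).

Definition form_cauchy (un : nat -> X -> R) := forall e : R, 0 < e -> exists N : nat,
  forall m n, (N <= m)%N -> (N <= n)%N ->
    dform (un m \- un n) (un m \- un n) < e.

Definition closable_form := forall un : nat -> X -> R, (forall n, C0inf E (un n)) ->
  L2cvg mu E un (cst 0) -> form_cauchy un ->
  dform (un n) (un n) @[n --> \oo] --> (0 : R).

Definition strong_sector := exists2 K : R, 0 < K &
  forall f g, C0inf E f -> C0inf E g ->
    `|dform f g| <= K * Num.sqrt (dform f f) * Num.sqrt (dform g g).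

(* The closure on L^2(D, mu) of the form restricted to core, used with
   D = E, core = C_0^infinity(E), and with D = V, core = C_0^infinity(V). *)
Definition form_approx D core un u :=
  [/\ forall n, core (un n), L2cvg mu D un u & form_cauchy un].

Definition form_dom D core u :=
  L2 mu D u /\ exists un, form_approx D core un u.

Definition form_closure D core u v (c : R) := exists un vn,
  [/\ form_approx D core un u, form_approx D core vn v &
      dform (un n) (vn n) @[n --> \oo] --> c].

(* Graph of the generator of the closed form: u is in the domain and is mapped
   to h iff form(u, v) = - (h, v) for every v in the domain of the form. *)
Definition form_generator D core u h :=
  [/\ form_dom D core u, L2 mu D h &
      forall v, form_dom D core v ->
        form_closure D core u v (- \int[mu]_(x in D) (h x * v x))].

Definition L0 := form_generator E (C0inf E).
Definition L0V V := form_generator V (C0inf_in E V).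

(* w is the weak gradient of u in D(E^0), extended from C_0^infinity(E) along
   approximating sequences of u as a limit in L^2_loc(E, R^d, mu). *)
Definition weak_grad u w :=
  [/\ forall i, L2loc mu E (fun x => w x ord0 i), L2 mu E u &
      exists2 un, form_approx E (C0inf E) un u &
        forall K, compact K -> K `<=` E -> forall i,
          L2cvg mu K (fun n => partial i (un n)) (fun x => w x ord0 i)].

Definition domL0_0b u :=
  [/\ exists h, L0 u h, compact (msupp mu E u) & ae_bounded mu E u].

Definition domL0_0b_dense :=
  (forall u, domL0_0b u -> L1 mu E u) /\
  forall f, L1 mu E f -> exists2 un, forall n, domL0_0b (un n) & L1cvg mu E un f.

Variable B : X -> X.

(* Graph of L^V u = L^{0,V} u + <B, grad u>, u in D(L^{0,V})_b, on L^1(V, mu);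
   u is extended by zero to an element of D(E^0). *)
Definition LV V u h := exists h0 w,
  [/\ L0V V u h0, ae_bounded mu V u, weak_grad (zext V u) w, L1 mu V h &
      {ae mu, forall x, V x -> h x = h0 x + dotv (B x) (w x)}].

Definition LV_closure V u h := [/\ L1 mu V u, L1 mu V h &
  exists un hn, [/\ forall n, L1 mu V (un n) /\ LV V (un n) (hn n),
    L1cvg mu V un u & L1cvg mu V hn h]].

End form.

Section semigroups.
Context {R : realType} {d : nat}.
Local Notation X := 'rV[R]_d.
Variables (mu : {measure set X -> \bar R}) (D : set X).
Implicit Types (a b c s t : R) (f g u h : X -> R).
Implicit Types (G T : R -> (X -> R) -> (X -> R)).

(* Sub-Markovian C_0-resolvents (and, below, semigroups) of contractions on
   L^1(D, mu).  The operators act on representatives and are required to respect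
   mu-a.e. equality on D; only parameters a, t > 0 matter. *)
Record C0_resolvent G : Prop := {
  resolvent_L1 : forall a f, 0 < a -> L1 mu D f -> L1 mu D (G a f) ;
  resolvent_ae : forall a f g, 0 < a -> L1 mu D f -> L1 mu D g ->
    ae_eq mu D f g -> ae_eq mu D (G a f) (G a g) ;
  resolvent_linear : forall a c f g, 0 < a -> L1 mu D f -> L1 mu D g ->
    ae_eq mu D (G a (fun x => c * f x + g x))
               (fun x => c * G a f x + G a g x) ;
  resolvent_contraction : forall a f, 0 < a -> L1 mu D f ->
    (\int[mu]_(x in D) `|(a * G a f x)%:E| <=
     \int[mu]_(x in D) `|(f x)%:E|)%E ;
  resolvent_submarkov : forall a f, 0 < a -> L1 mu D f ->
    {ae mu, forall x, D x -> 0 <= f x <= 1} ->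
    {ae mu, forall x, D x -> 0 <= a * G a f x <= 1} ;
  resolvent_eq : forall a b f, 0 < a -> 0 < b -> L1 mu D f ->
    ae_eq mu D (fun x => G a f x - G b f x)
               (fun x => (b - a) * G a (G b f) x) ;
  resolvent_C0 : forall f, L1 mu D f ->
    L1dist mu D (fun x => a * G a f x) f @[a --> +oo] --> 0%E }.

(* Graph of the generator of a resolvent: h = a u - G_a^{-1} u. *)
Definition resolvent_generator G u h := [/\ L1 mu D u, L1 mu D h &
  forall a, 0 < a -> ae_eq mu D u (G a (fun x => a * u x - h x))].

Record C0_semigroup T : Prop := {
  semigroup_L1 : forall t f, 0 < t -> L1 mu D f -> L1 mu D (T t f) ;
  semigroup_ae : forall t f g, 0 < t -> L1 mu D f -> L1 mu D g ->
    ae_eq mu D f g -> ae_eq mu D (T t f) (T t g) ;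
  semigroup_linear : forall t c f g, 0 < t -> L1 mu D f -> L1 mu D g ->
    ae_eq mu D (T t (fun x => c * f x + g x))
               (fun x => c * T t f x + T t g x) ;
  semigroup_contraction : forall t f, 0 < t -> L1 mu D f ->
    (\int[mu]_(x in D) `|(T t f x)%:E| <= \int[mu]_(x in D) `|(f x)%:E|)%E ;
  semigroup_submarkov : forall t f, 0 < t -> L1 mu D f ->
    {ae mu, forall x, D x -> 0 <= f x <= 1} ->
    {ae mu, forall x, D x -> 0 <= T t f x <= 1} ;
  semigroup_add : forall s t f, 0 < s -> 0 < t -> L1 mu D f ->
    ae_eq mu D (T (s + t) f) (T s (T t f)) ;
  semigroup_C0 : forall f, L1 mu D f ->
    L1dist mu D (T t f) f @[t --> 0^'+] --> 0%E }.

Definition semigroup_generator T u h := [/\ L1 mu D u, L1 mu D h &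
  L1dist mu D (fun x => t^-1 * (T t u x - u x)) h @[t --> 0^'+] --> 0%E].

(* \int_0^N T_t f dt, the L^1(D, mu)-valued integral of the continuous curve
   t |-> T_t f, i.e. the L^1-limit of its (right end-point) Riemann sums. *)
Definition riemann_sum T f (N : R) (n : nat) : X -> R := fun x =>
  \sum_(k < n.+1) (N / n.+1%:R) * T (k.+1%:R * (N / n.+1%:R)) f x.

Definition time_integral T f (N : R) : X -> R :=
  xget (cst 0) [set g | L1 mu D g /\ L1cvg mu D (riemann_sum T f N) g].

Definition potential T f : X -> \bar R := fun x =>
  lim ((time_integral T f N%:R x)%:E @[N --> \oo]).

Definition recurrent T := forall f, L1 mu D f ->
  {ae mu, forall x, D x -> 0 <= f x} ->
  {ae mu, forall x, D x -> potential T f x = 0%E \/ potential T f x = +oo%E}.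

(* Extension of T_t to nonnegative f in L^infinity(D, mu): g is the extension
   T_t f iff T_t f_n --> g a.e. for any (f_n) as below. *)
Definition increasing_approx (fn : nat -> X -> R) f :=
  (forall n, L1 mu D (fn n) /\ ae_bounded mu D (fn n)) /\
  {ae mu, forall x, D x ->
    (forall n, 0 <= fn n x <= fn n.+1 x) /\ fn n x @[n --> \oo] --> f x}.

Definition Linfty_extension T t f g :=
  (exists fn, increasing_approx fn f) /\
  forall fn, increasing_approx fn f ->
    {ae mu, forall x, D x -> T t (fn n) x @[n --> \oo] --> g x}.

(* T_t 1 = 1 for every t > 0; by the semigroup property this is equivalent to
   the same identity for some t > 0. *)
Definition conservative T :=
  forall t, 0 < t -> Linfty_extension T t (cst 1) (cst 1).

End semigroups.

Section Tbar.
Context {R : realType} {d : nat}.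
Local Notation X := 'rV[R]_d.
Variables (mu : {measure set X -> \bar R}) (E : set X).
Variables (A : X -> 'M[R]_d) (B : X -> X).

Definition exhaustion (Vn : nat -> set X) :=
  [/\ forall n, relcompact E (Vn n), forall n, closure (Vn n) `<=` Vn n.+1 &
      \bigcup_n Vn n = E].

(* GV V is the resolvent generated by the closure of L^V on L^1(V, mu), G is
   the limit of (GV V_n) along exhaustions (each x in E lies in V_n for large
   n, so the values of GV V_n outside V_n are irrelevant), and T is the
   semigroup with the same generator as G.  Equality of the graph of the closure
   of L^V with that of a generator entails that L^V is closable. *)
Definition is_Tbar (T : R -> (X -> R) -> (X -> R)) :=
  exists (GV : set X -> R -> (X -> R) -> (X -> R))
         (G : R -> (X -> R) -> (X -> R)),
  [/\ forall V, relcompact E V -> C0_resolvent mu V (GV V) /\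
        forall u h, resolvent_generator mu V (GV V) u h <->
                    LV_closure mu E A B V u h,
      C0_resolvent mu E G,
      forall Vn, exhaustion Vn -> forall (a : R) f, 0 < a -> L1 mu E f ->
        {ae mu, forall x, E x ->
          GV (Vn n) a (zext (Vn n) f) x @[n --> \oo] --> G a f x},
      C0_semigroup mu E T &
      forall u h, semigroup_generator mu E T u h <->
                  resolvent_generator mu E G u h].

End Tbar.

(* Main.v *)
(* This is a fact about sub-Markovian C_0-semigroups of contractions on L^1.  Write
   T_t 1 for the extension of T_t to the constant 1.  If f >= 0 is integrable and
   f <= 1 - T_m 1, then T_t f <= T_t 1 - T_{t+m} 1, so that int_0^N T_t f dt
   telescopes and is at most int_0^m T_t 1 dt <= m for every N.  The potential of f
   is thus finite, hence 0 by recurrence, which forces f = 0.  As such f exhaust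
   1 - T_m 1, one gets T_m 1 = 1, for every integer m >= 1; and t |-> T_t 1 is
   nonincreasing.  At the level of Riemann sums the telescoping is exact when the
   mesh divides m, whence the choice of an integer m. *)
Require Import Defs.
From HB Require Import structures.
From mathcomp Require Import all_boot all_order all_algebra.
From mathcomp Require Import all_classical all_reals all_analysis measurable_realfun.
From mathcomp Require Import ring lra.
Import Order.TTheory GRing.Theory Num.Theory.
Import numFieldNormedType.Exports.
Local Open Scope classical_set_scope.
Local Open Scope ring_scope.

Set Implicit Arguments.
Unset Strict Implicit.

(** * Preliminaries on limits and finite sums *)

(** The bound for [e = 1] makes [h] eventually finite, which reduces the claim to real limits. The
    filter is arbitrary because both [n --> \oo] and [t --> 0^'+] occur below. *)
Lemma ge0_cvge0P (R : realType) (T : Type) (F : set_system T) (FF : Filter F)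
    (h : T -> \bar R) : (forall x, (0 <= h x)%E) ->
  (h x @[x --> F] --> 0%E <-> forall e : R, 0 < e -> \forall x \near F, (h x <= e%:E)%E).
Proof.
move=> h0; split=> [/fine_cvgP[hfin h_cvg] e e0|h_le].
  move/cvgr0Pnorm_le : h_cvg => /(_ _ e0) h_cvg.
  near=> x; have hx : h x \is a fin_num by near: x.
  rewrite -(fineK hx) lee_fin (le_trans (ler_norm _))//.
  by near: x; exact: h_cvg.
apply/fine_cvgP; split.
  near=> x; rewrite ge0_fin_numE// (@le_lt_trans _ _ 1%:E) ?ltry//.
  by near: x; exact: h_le.
apply/cvgr0Pnorm_le => e e0; near=> x.
have hx : (h x <= e%:E)%E by near: x; exact: h_le.
rewrite ger0_norm ?fine_ge0//= -lee_fin fineK//.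
by rewrite ge0_fin_numE// (le_lt_trans hx)// ltry.
Unshelve. all: by end_near. Qed.

(** Serves to write a Riemann sum over the index set of a refinement, each coarse node being
    repeated [m] times. *)
Lemma sum_divn (V : nmodType) (F : nat -> V) l m : (0 < m)%N ->
  \sum_(k < l * m) F (k %/ m)%N = (\sum_(k < l) F k) *+ m.
Proof.
move=> m0; elim: l => [|l ih]; first by rewrite mul0n !big_ord0 mul0rn.
rewrite big_ord_recr/= mulrnDl -ih -(big_mkord xpredT (fun k => F (k %/ m)%N)).
rewrite -(big_mkord xpredT (fun k => F (k %/ m)%N)) mulSn addnC.
rewrite (@big_cat_nat _ _ _ (l * m)%N) ?leq_addr//=; congr (_ + _).
rewrite -{1}(add0n (l * m)%N) big_addn addKn big_mkord.
rewrite (eq_bigr (fun=> F l)) ?sumr_const ?card_ord// => i _.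
by rewrite divnDMl// divn_small.
Qed.

(** The sum telescopes with shift [q]: what is left is the first [q] values minus the [q] values
    from index [l] on. This identity also covers [l < q]. *)
Lemma sum_shift_le (R : realType) (a : nat -> R) (q l : nat) : (forall k, 0 <= a k <= 1) ->
  \sum_(k < l) (a k - a (k + q)%N) <= q%:R.
Proof.
move=> a01.
have -> : \sum_(k < l) (a k - a (k + q)%N) = \sum_(k < q) a k - \sum_(k < q) a (l + k)%N.
  elim: l => [|l ih]; first by rewrite big_ord0 subrr.
  rewrite big_ord_recr/= {}ih; case: q => [|q]; first by rewrite !big_ord0 addn0 !subrr addr0.
  have -> : \sum_(k < q.+1) a (l + k)%N = a l + \sum_(k < q) a (l.+1 + k)%N.
    rewrite big_ord_recl addn0; congr (_ + _); apply: eq_bigr => i _.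
    by rewrite /= /bump leq0n addnA addn1.
  rewrite [in RHS](big_ord_recr q (fun k => a (l.+1 + k)%N))/= (addSnnS l q).
  by ring.
rewrite lerBlDr (@le_trans _ _ q%:R)//; last first.
  by rewrite lerDl sumr_ge0// => k _; case/andP: (a01 (l + k)%N).
rewrite -[leRHS](_ : \sum_(k < q) 1 = _); last by rewrite sumr_const card_ord.
by apply: ler_sum => k _; case/andP: (a01 k).
Qed.

(** * Calculus of the [L^1] distance *)

Section L1_space.
Context {R : realType} {d : nat} {mu : {measure set 'rV[R]_d -> \bar R}}.
Context {D : set 'rV[R]_d}.
Hypothesis mD : measurable D.
Implicit Types f g h : 'rV[R]_d -> R.

Lemma L1_measurable f : L1 mu D f -> measurable_fun D f.
Proof. by move=> /measurable_int /measurable_EFinP. Qed.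

Lemma L1D f g : L1 mu D f -> L1 mu D g -> L1 mu D (fun x => f x + g x).
Proof. by move=> f1 g1; apply: integrableD f1 g1. Qed.

Lemma L1Z (c : R) f : L1 mu D f -> L1 mu D (fun x => c * f x).
Proof. by move=> f1; apply: (integrableZl mD c f1). Qed.

Lemma L1B f g : L1 mu D f -> L1 mu D g -> L1 mu D (fun x => f x - g x).
Proof. by move=> f1 g1; apply: (integrableB mD f1 g1). Qed.

Lemma L1_0 : L1 mu D (cst 0).
Proof. exact: integrable0. Qed.

Lemma L1_sum n (F : nat -> 'rV[R]_d -> R) : (forall k, L1 mu D (F k)) ->
  L1 mu D (fun x => \sum_(k < n) F k x).
Proof.
move=> F1; elim: n => [|n ih].
  by under eq_fun do rewrite big_ord0; exact: L1_0.
by under eq_fun do rewrite big_ord_recr/=; exact: L1D.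
Qed.

Lemma le_L1 f g : measurable_fun D f ->
  {ae mu, forall x, D x -> `|f x| <= `|g x|} -> L1 mu D g -> L1 mu D f.
Proof.
move=> mf fg /integrableP[mg g_fin]; apply/integrableP; split; first exact/measurable_EFinP.
apply: le_lt_trans g_fin; apply: ae_ge0_le_integral => //.
- by apply: (measurableT_comp (@abse_measurable _ setT)) => //; exact/measurable_EFinP.
- exact: (measurableT_comp (@abse_measurable _ setT)).
Qed.

Lemma L1_min f g : L1 mu D f -> L1 mu D g -> L1 mu D (fun x => Num.min (f x) (g x)).
Proof.
move=> f1 g1; have fg1 : L1 mu D (fun x => `|f x| + `|g x|).
  by apply: L1D; [exact: (integrable_norm f1)|exact: (integrable_norm g1)].
apply: le_L1 fg1; first by apply: measurable_minr; exact: L1_measurable.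
apply: aeW => x _; rewrite [leRHS]ger0_norm ?addr_ge0//.
by rewrite /Num.min; case: ifP => _; rewrite ?lerDl ?lerDr.
Qed.

Lemma measurable_L1dist f g : measurable_fun D f -> measurable_fun D g ->
  measurable_fun D (fun x => `|(f x - g x)%:E|%E).
Proof.
move=> mf mg; apply: (measurableT_comp (@abse_measurable _ setT)) => //.
by apply/measurable_EFinP; exact: measurable_funB.
Qed.

Lemma L1dist_ge0 f g : (0 <= L1dist mu D f g)%E.
Proof. exact: integral_ge0. Qed.

Lemma L1distC f g : L1dist mu D f g = L1dist mu D g f.
Proof. by apply: eq_integral => x _; rewrite /= distrC. Qed.

Lemma L1distxx f : L1dist mu D f f = 0%E.
Proof.
by rewrite /L1dist; under eq_integral do rewrite subrr abse0; rewrite integral0.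
Qed.

Lemma L1dist_le f g h k : L1 mu D f -> L1 mu D g -> L1 mu D h -> L1 mu D k ->
  {ae mu, forall x, D x -> `|f x - g x| <= `|h x - k x|} ->
  (L1dist mu D f g <= L1dist mu D h k)%E.
Proof.
move=> /L1_measurable mf /L1_measurable mg /L1_measurable mh /L1_measurable mk fghk.
by apply: ae_ge0_le_integral => //; do ?exact: measurable_L1dist.
Qed.

Lemma L1dist_ae f g h : L1 mu D f -> L1 mu D g -> L1 mu D h ->
  ae_eq mu D f g -> L1dist mu D f h = L1dist mu D g h.
Proof.
move=> f1 g1 h1 fg; apply/le_anti/andP; split; apply: L1dist_le => //;
  by apply: filterS fg => x /[apply] ->.
Qed.

Lemma L1distD f g h k : L1 mu D f -> L1 mu D g -> L1 mu D h -> L1 mu D k ->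
  (L1dist mu D (fun x => (f x + h x)%R) (fun x => (g x + k x)%R)
     <= L1dist mu D f g + L1dist mu D h k)%E.
Proof.
move=> /L1_measurable mf /L1_measurable mg /L1_measurable mh /L1_measurable mk.
rewrite /L1dist -ge0_integralD//; do ?exact: measurable_L1dist.
apply: ge0_le_integral => //.
- by apply: measurable_L1dist; exact: measurable_funD.
- by apply: emeasurable_funD; exact: measurable_L1dist.
- by move=> x _ /=; rewrite lee_fin opprD addrACA ler_normD.
Qed.

Lemma L1distZ (c : R) f g : L1 mu D f -> L1 mu D g ->
  (L1dist mu D (fun x => (c * f x)%R) (fun x => (c * g x)%R) = `|c|%:E * L1dist mu D f g)%E.
Proof.
move=> /L1_measurable mf /L1_measurable mg.
rewrite /L1dist -ge0_integralZl_EFin//; last exact: measurable_L1dist.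
by apply: eq_integral => x _; rewrite /= -EFinM -mulrBr normrM.
Qed.

Lemma L1dist_triangle g f h : L1 mu D f -> L1 mu D g -> L1 mu D h ->
  (L1dist mu D f h <= L1dist mu D f g + L1dist mu D g h)%E.
Proof.
move=> f1 g1 h1; apply: le_trans (L1distD f1 g1 g1 h1).
by apply: L1dist_le; [| |exact: L1D|exact: L1D|apply: aeW => x _; rewrite addrKA].
Qed.

Lemma L1dist_sum n (e : R) (F G : nat -> 'rV[R]_d -> R) :
  (forall k, L1 mu D (F k)) -> (forall k, L1 mu D (G k)) ->
  (forall k, (k < n)%N -> (L1dist mu D (F k) (G k) <= e%:E)%E) ->
  (L1dist mu D (fun x => \sum_(k < n) F k x)%R (fun x => \sum_(k < n) G k x)%R
    <= (e *+ n)%:E)%E.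
Proof.
move=> F1 G1; elim: n => [|n ih] FG.
  by under eq_fun do rewrite big_ord0; under [X in L1dist _ _ _ X]eq_fun do rewrite big_ord0;
     rewrite L1distxx mulr0n.
under eq_fun do rewrite big_ord_recr/=.
under [X in L1dist _ _ _ X]eq_fun do rewrite big_ord_recr/=.
apply: le_trans (L1distD _ _ _ _) _; [exact: L1_sum|exact: L1_sum|by []|by []|].
by rewrite mulrSr EFinD leeD// ?FG// ih// => k kn; rewrite FG// ltnS ltnW.
Qed.

Lemma L1cvgP (u : nat -> 'rV[R]_d -> R) f : L1cvg mu D u f <->
  forall e : R, 0 < e -> \forall n \near \oo, (L1dist mu D (u n) f <= e%:E)%E.
Proof. by apply: ge0_cvge0P => n; exact: L1dist_ge0. Qed.

Lemma L1cvgB (u v : nat -> 'rV[R]_d -> R) f g :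
  (forall n, L1 mu D (u n)) -> (forall n, L1 mu D (v n)) -> L1 mu D f -> L1 mu D g ->
  L1cvg mu D u f -> L1cvg mu D v g ->
  L1cvg mu D (fun n x => u n x - v n x) (fun x => f x - g x).
Proof.
move=> u1 v1 f1 g1 /L1cvgP uf /L1cvgP vg; apply/L1cvgP => e e0.
have e20 : 0 < e / 2 by rewrite divr_gt0.
apply: filterS2 (uf _ e20) (vg _ e20) => n ufn vgn.
have N1 h : L1 mu D h -> L1 mu D (fun x => - h x) by move=> h1; exact: integrableN h1.
apply: le_trans (L1distD (u1 n) f1 (N1 _ (v1 n)) (N1 _ g1)) _.
rewrite [e]splitr EFinD leeD//; apply: le_trans vgn; apply: L1dist_le => //; do ?exact: N1.
by apply: aeW => x _; rewrite -opprD normrN.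
Qed.

End L1_space.

(** * Completeness of [L^1] and almost everywhere limits *)

Section L1_completeness.
Context {R : realType} {d : nat} {mu : {measure set 'rV[R]_d -> \bar R}}.
Context {D : set 'rV[R]_d}.
Hypothesis mD : measurable D.
Implicit Types (f g h : 'rV[R]_d -> R) (u : nat -> 'rV[R]_d -> R).

(** Sum and integral may be exchanged, and the geometric bounds add up to at most 1. *)
Lemma L1_fast_summable u : (forall k, measurable_fun D (u k)) ->
  (forall k, (\int[mu]_(x in D) `|(u k x)%:E| <= (1 / (2 ^ k.+1)%:R)%:E)%E) ->
  mu.-integrable D (fun x => \sum_(k <oo) `|(u k x)%:E|)%E.
Proof.
move=> mu_ u_le; have mau k : measurable_fun D (fun x => `|(u k x)%:E|%E).
  by apply: (measurableT_comp (@abse_measurable _ setT)) => //; exact/measurable_EFinP.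
apply/integrableP; split; first exact: ge0_emeasurable_sum.
under eq_integral => x _ do rewrite gee0_abs ?nneseries_ge0//.
rewrite integral_nneseries//.
apply: (@le_lt_trans _ _ (\sum_(k <oo) (1 / (2 ^ k.+1)%:R : R)%:E)%E).
  by apply: lee_nneseries => // k *; exact: integral_ge0.
exact: le_lt_trans (epsilon_trick0 _ ler01) (ltry 1).
Qed.

Lemma L1_fast_ae_cvg_series u : (forall k, measurable_fun D (u k)) ->
  (forall k, (\int[mu]_(x in D) `|(u k x)%:E| <= (1 / (2 ^ k.+1)%:R)%:E)%E) ->
  {ae mu, forall x, D x -> cvgn [normed series (u ^~ x)]}.
Proof.
move=> mu_ u_le; apply: filterS (integrable_ae mD (L1_fast_summable mu_ u_le)).
move=> x /[apply] fin_sum; apply: nondecreasing_is_cvgn.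
  by apply: nondecreasing_series => k _ _; exact: normr_ge0.
exists (fine (\sum_(k <oo) `|(u k x)%:E|)%E) => _ [n _ <-].
rewrite -lee_fin fineK// /series/= -sumEFin.
exact: nneseries_lim_ge.
Qed.

(** The series of the differences [u k - f] converges absolutely almost everywhere, so its terms
    tend to 0. *)
Lemma L1_fast_ae_cvg u f : (forall k, L1 mu D (u k)) -> L1 mu D f ->
  (forall k, (L1dist mu D (u k) f <= (1 / (2 ^ k.+1)%:R)%:E)%E) ->
  {ae mu, forall x, D x -> u k x @[k --> \oo] --> f x}.
Proof.
move=> u1 f1 uf.
have muf k : measurable_fun D (fun x => u k x - f x).
  exact: measurable_funB (L1_measurable (u1 k)) (L1_measurable f1).
apply: filterS (L1_fast_ae_cvg_series muf uf) => x /[apply] /cvg_series_cvg_0.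
by move=> /norm_cvg0/subr_cvg0.
Qed.

(** Riesz-Fischer argument: the telescoping series converges almost everywhere, and dominated
    convergence turns this into [L^1] convergence. *)
Lemma L1_fast_complete u : (forall k, L1 mu D (u k)) ->
  (forall k, (L1dist mu D (u k.+1) (u k) <= (1 / (2 ^ k.+1)%:R)%:E)%E) ->
  exists2 f, L1 mu D f & L1cvg mu D u f.
Proof.
move=> u1 du; have mu_ k := L1_measurable (u1 k).
have mdu k : measurable_fun D (fun x => u k.+1 x - u k x) by exact: measurable_funB.
pose S x := (\sum_(k <oo) `|(u k.+1 x - u k x)%:E|)%E.
have iS : mu.-integrable D S by exact: (L1_fast_summable mdu du).
have u_cvg := L1_fast_ae_cvg_series mdu du.
(* The limsup is measurable everywhere and equals the limit wherever the sequence converges. *)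
pose f x := fine (limn_esup (fun k => (u k x)%:E)).
have mf : measurable_fun D f.
  apply: (measurableT_comp (@fine_measurable _ setT _)) => //.
  by apply: measurable_fun_limn_esup => k; exact/measurable_EFinP.
have u_f : {ae mu, forall x, D x -> u k x @[k --> \oo] --> f x}.
  apply: filterS u_cvg => x /[apply] /normed_cvg du_cvg.
  have {}du_cvg : cvgn (u ^~ x).
    rewrite (_ : u ^~ x = (fun n => u 0%N x + series (telescope (u ^~ x)) n)).
      by apply: is_cvgD => //; exact: is_cvg_cst.
    by apply/funext => n; exact: eq_sum_telescope.
  suff -> : f x = limn (u ^~ x) by [].
  have /cvg_limn_einf_sup[_] : (u k x)%:E @[k --> \oo] --> (limn (u ^~ x))%:E.
    by apply: cvg_EFin; [exact: nearW|exact: du_cvg].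
  by rewrite /f => ->.
have u_le : {ae mu, forall x n, D x -> (`|(u n x)%:E| <= `|(u 0%N x)%:E| + S x)%E}.
  apply: aeW => x n Dx.
  apply: (@le_trans _ _ (`|(u 0%N x)%:E| +
      \sum_(0 <= k < n) `|(u k.+1 x - u k x)%:E|)%E).
    rewrite /= sumEFin lee_fin [u n x](eq_sum_telescope (u ^~ x)).
    by rewrite (le_trans (ler_normD _ _))// lerD2l ler_norm_sum.
  by rewrite leeD2l//; exact: nneseries_lim_ge.
have iu0S : mu.-integrable D (fun x => `|(u 0%N x)%:E| + S x)%E.
  by apply: integrableD => //; exact: (integrable_abse (u1 0%N)).
have mEu n : measurable_fun D (EFin \o u n) by exact/measurable_EFinP.
have mEf : measurable_fun D (EFin \o f) by exact/measurable_EFinP.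
have u_Ef : {ae mu, forall x, D x -> (EFin \o u n) x @[n --> \oo] --> (EFin \o f) x}.
  by apply: filterS u_f => x /[apply] uf; apply: cvg_EFin => //; exact: nearW.
by have [f1 uf _] := dominated_convergence mD mEu mEf u_Ef iu0S u_le; exists f.
Qed.

Lemma L1_complete u : (forall k, L1 mu D (u k)) ->
  (forall e : R, 0 < e -> exists N, forall m n, (N <= m)%N -> (N <= n)%N ->
    (L1dist mu D (u m) (u n) <= e%:E)%E) ->
  exists2 f, L1 mu D f & L1cvg mu D u f.
Proof.
move=> u1 u_cauchy.
have /choice[N NP] k : exists N, forall m n, (N <= m)%N -> (N <= n)%N ->
    (L1dist mu D (u m) (u n) <= (1 / (2 ^ k.+1)%:R)%:E)%E.
  by apply: u_cauchy; rewrite divr_gt0// ltr0n expn_gt0.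
(* [M k] bounds both [k] and [N k], and [M] is nondecreasing, so [u \o M] is a fast sequence with
   indices tending to infinity. *)
pose M k := (k + \sum_(i < k.+1) N i)%N.
have NM k : (N k <= M k)%N by rewrite /M big_ord_recr/= addnA leq_addl.
have [k|k|f f1 /L1cvgP uf] := @L1_fast_complete (u \o M).
- exact: u1.
- apply: NP => //; rewrite (leq_trans (NM k))// [leqRHS]/M big_ord_recr/=.
  by rewrite addnA (leq_trans _ (leq_addr _ _))// leq_add2r.
exists f => //; apply/L1cvgP => e e0.
have e20 : 0 < e / 2 by rewrite divr_gt0.
have [N0 N0P] := u_cauchy _ e20; have [k0 _ k0P] := uf _ e20.
exists N0 => // n /= N0n; pose k := maxn k0 N0; rewrite [e]splitr EFinD.
apply: le_trans (L1dist_triangle mD (u1 n) (u1 (M k)) f1) _; apply: leeD.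
  by apply: N0P => //; rewrite (leq_trans (leq_maxr k0 N0))// leq_addr.
by apply: k0P; exact: leq_maxl.
Qed.

(** A fast subsequence converges almost everywhere, and the inequality passes to its limit. The
    bound [h] is an arbitrary function, since constants and [ext1 t] are used for it below. *)
Lemma L1_order_closed (v : nat -> 'rV[R]_d -> R) f h :
  (forall k, L1 mu D (v k)) -> L1 mu D f -> L1cvg mu D v f ->
  (forall k, {ae mu, forall x, D x -> v k x <= h x}) ->
  {ae mu, forall x, D x -> f x <= h x}.
Proof.
move=> v1 f1 /L1cvgP vf vh.
have /choice[N NP] k : exists N, (L1dist mu D (v N) f <= (1 / (2 ^ k.+1)%:R)%:E)%E.
  have [|N _ NP] := vf (1 / (2 ^ k.+1)%:R); first by rewrite divr_gt0// ltr0n expn_gt0.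
  by exists N; exact: NP (leqnn N).
have v_cvg := @L1_fast_ae_cvg (v \o N) f (fun k => v1 (N k)) f1 NP.
apply: filterS2 v_cvg (ae_foralln vh) => x + + Dx => /(_ Dx) vx vhx.
have vxc : cvgn (fun k => v (N k) x) by apply/cvg_ex; exists (f x).
rewrite -(cvg_lim _ vx)//; apply: limr_le => //.
by apply: nearW => k; exact: vhx.
Qed.

End L1_completeness.

(** * Continuity of the semigroup and convergence of Riemann sums *)

Section semigroup.
Context {R : realType} {d : nat} {mu : {measure set 'rV[R]_d -> \bar R}}.
Context {D : set 'rV[R]_d} (T : R -> ('rV[R]_d -> R) -> 'rV[R]_d -> R).
Hypotheses (mD : measurable D) (TC0 : C0_semigroup mu D T).
Implicit Types (f g h : 'rV[R]_d -> R) (r s t N e : R).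

Lemma semigroup_addf t f g : 0 < t -> L1 mu D f -> L1 mu D g ->
  ae_eq mu D (T t (fun x => f x + g x)) (fun x => T t f x + T t g x).
Proof.
move=> t0 f1 g1; have := semigroup_linear TC0 1 t0 f1 g1.
rewrite (_ : (fun x => 1 * f x + g x) = (fun x => f x + g x)).
  by apply: filterS => x /[apply] ->; rewrite mul1r.
by apply/funext => x; rewrite mul1r.
Qed.

Lemma semigroup_subf t f g : 0 < t -> L1 mu D f -> L1 mu D g ->
  ae_eq mu D (T t (fun x => f x - g x)) (fun x => T t f x - T t g x).
Proof.
move=> t0 f1 g1; have := semigroup_linear TC0 (-1) t0 g1 f1.
rewrite (_ : (fun x => -1 * g x + f x) = (fun x => f x - g x)).
  by apply: filterS => x /[apply] ->; rewrite mulN1r addrC.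
by apply/funext => x; rewrite mulN1r addrC.
Qed.

Lemma semigroup_L1dist t f g : 0 < t -> L1 mu D f -> L1 mu D g ->
  (L1dist mu D (T t f) (T t g) <= L1dist mu D f g)%E.
Proof.
move=> t0 f1 g1; apply: le_trans (semigroup_contraction TC0 t0 (L1B mD f1 g1)).
have T1 h : L1 mu D h -> L1 mu D (T t h) by exact: (semigroup_L1 TC0 t0).
have mTB := L1_measurable (T1 _ (L1B mD f1 g1)).
have mTf := L1_measurable (T1 _ f1); have mTg := L1_measurable (T1 _ g1).
rewrite le_eqVlt; apply/orP; left; apply/eqP; apply: ge0_ae_eq_integral => //.
- exact: measurable_L1dist.
- by apply: (measurableT_comp (@abse_measurable _ setT)) => //; exact/measurable_EFinP.
- by apply: filterS (semigroup_subf t0 f1 g1) => x /[apply] ->.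
Qed.

(** Positivity is applied to [g - f]; as the sub-Markov property concerns functions with values in
    [0, 1], the difference is also bounded by 1. *)
Lemma semigroup_homo t f g : 0 < t -> L1 mu D f -> L1 mu D g ->
  {ae mu, forall x, D x -> 0 <= g x - f x <= 1} ->
  {ae mu, forall x, D x -> T t f x <= T t g x}.
Proof.
move=> t0 f1 g1 fg.
apply: filterS2 (semigroup_submarkov TC0 t0 (L1B mD g1 f1) fg) (semigroup_subf t0 g1 f1).
by move=> x + + Dx => /(_ Dx) /andP[T0 _] /(_ Dx) TE; rewrite -subr_ge0 -TE.
Qed.

(** [T b f - T a f] is [T a] applied to [T (b - a) f - f], so contractivity carries the modulus at
    time 0 to all times. *)
Lemma semigroup_modulus (eta e : R) f a b : L1 mu D f -> 0 <= e ->
  (forall t, 0 < t <= eta -> (L1dist mu D (T t f) f <= e%:E)%E) ->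
  0 < a -> a <= b <= a + eta -> (L1dist mu D (T b f) (T a f) <= e%:E)%E.
Proof.
move=> f1 e0 fe a0 /andP[]; rewrite le_eqVlt => /predU1P[<- _|ab beta].
  by rewrite L1distxx lee_fin.
have ba0 : 0 < b - a by rewrite subr_gt0.
have T1 t h : 0 < t -> L1 mu D h -> L1 mu D (T t h) by exact: (semigroup_L1 TC0).
have b0 : 0 < b by exact: lt_trans ab.
rewrite (@L1dist_ae _ _ _ _ mD _ (T a (T (b - a) f))) ?T1//.
  by apply: le_trans (semigroup_L1dist _ _ _) _; rewrite ?T1// fe// ba0 lerBlDl.
have := semigroup_add TC0 a0 ba0 f1.
by rewrite addrC subrK.
Qed.

Lemma semigroup_small_time f e : L1 mu D f -> 0 < e -> exists2 eta : R, 0 < eta &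
  forall t, 0 < t <= eta -> (L1dist mu D (T t f) f <= e%:E)%E.
Proof.
move=> f1 e0; have /ge0_cvge0P := semigroup_C0 TC0 f1.
move=> /(_ (fun t => L1dist_ge0 _ _) e e0).
rewrite /at_right /= => -[eta /= eta0 etaP].
(* Halving lets the closed bound [t <= eta / 2] fit into the open neighbourhood of 0. *)
exists (eta / 2); first by rewrite divr_gt0.
move=> t /andP[t0 te]; apply: etaP => //=.
rewrite sub0r normrN gtr0_norm// (le_lt_trans te)// ltr_pdivrMr// mulr_natr mulr2n ltrDl //.
Qed.

(* [riemann_sum T f N n] is [step_sum f (N / n.+1%:R) n.+1], but here the mesh
   is a free parameter, so that horizons can vary at fixed mesh. *)
Definition step_sum f (delta : R) (l : nat) : 'rV[R]_d -> R :=
  fun x => \sum_(k < l) delta * T (k.+1%:R * delta) f x.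

Lemma L1_step_sum f delta l : L1 mu D f -> 0 < delta -> L1 mu D (step_sum f delta l).
Proof.
move=> f1 delta0; apply: (@L1_sum _ _ _ _ mD l (fun k x => delta * T (k.+1%:R * delta) f x)) => k.
by apply: L1Z => //; apply: (semigroup_L1 TC0) => //; rewrite mulr_gt0.
Qed.

(** Each coarse node exceeds the [m] fine nodes replacing it by at most [delta], so each of the
    [l * m] terms errs by at most [delta / m * e]. *)
Lemma step_sum_refine f delta l m e : L1 mu D f -> 0 < delta -> (0 < m)%N -> 0 <= e ->
  (forall t, 0 < t <= delta -> (L1dist mu D (T t f) f <= e%:E)%E) ->
  (L1dist mu D (step_sum f delta l) (step_sum f (delta / m%:R) (l * m)) <=
   (l%:R * delta * e)%:E)%E.
Proof.
move=> f1 delta0 m0 e0 fe; have m0' : 0 < m%:R :> R by rewrite ltr0n.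
have dm0 : 0 < delta / m%:R by rewrite divr_gt0.
have T1 t : 0 < t -> L1 mu D (T t f) by move=> t0; exact: (semigroup_L1 TC0).
rewrite [step_sum f delta l](_ : _ = (fun x => \sum_(k < l * m)
    (delta / m%:R * T ((k %/ m).+1%:R * delta) f x))); last first.
  apply/funext => x; rewrite (sum_divn (fun k => delta / m%:R * T (k.+1%:R * delta) f x))//.
  rewrite -sumrMnl; apply: eq_bigr => k _.
  by rewrite -[RHS]mulr_natr mulrAC divfK ?gt_eqF.
have -> : l%:R * delta * e = (delta / m%:R * e) *+ (l * m).
  by rewrite -[RHS]mulr_natr natrM; field; rewrite gt_eqF.
apply: (L1dist_sum mD (F := fun k x => delta / m%:R * T ((k %/ m).+1%:R * delta) f x)
  (G := fun k x => delta / m%:R * T (k.+1%:R * (delta / m%:R)) f x)) => k.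
- by apply: L1Z => //; rewrite T1// mulr_gt0.
- by apply: L1Z => //; rewrite T1// mulr_gt0.
move=> _; rewrite L1distZ// ?T1// ?mulr_gt0 ?invr_gt0//.
rewrite gtr0_norm// [leRHS]EFinM lee_wpmul2l ?lee_fin ?(ltW dm0)//.
apply: semigroup_modulus fe _ _ => //; first by rewrite mulr_gt0.
have deltaE : delta = m%:R * (delta / m%:R) by rewrite mulrC divfK ?gt_eqF.
(* In units of the fine mesh, the two comparisons of times become
   [k.+1 <= (k %/ m).+1 * m <= k.+1 + m]. *)
move: (delta / m%:R) dm0 deltaE => y y0 ->; rewrite mulrA -mulrDl.
rewrite !ler_pM2r// -natrM -natrD !ler_nat ltn_ceil//= mulSn addnC leq_add2r.
by rewrite leqW// leq_divM.
Qed.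

Lemma step_sum_small_time f delta l e : L1 mu D f -> 0 < delta -> 0 <= e ->
  (forall t, 0 < t <= l%:R * delta -> (L1dist mu D (T t f) f <= e%:E)%E) ->
  (L1dist mu D (step_sum f delta l) (fun x => l%:R * delta * f x)%R <= (l%:R * delta * e)%:E)%E.
Proof.
move=> f1 delta0 e0 fe.
have T1 t : 0 < t -> L1 mu D (T t f) by move=> t0; exact: (semigroup_L1 TC0).
rewrite [X in L1dist _ _ _ X](_ : _ = (fun x => \sum_(k < l) (delta * f x))); last first.
  by apply/funext => x; rewrite sumr_const card_ord -mulrA -[RHS]mulr_natl.
rewrite -mulrA mulr_natl.
apply: (L1dist_sum mD (F := fun k x => delta * T (k.+1%:R * delta) f x)
  (G := fun k x => delta * f x)) => k.
- by apply: L1Z => //; rewrite T1// mulr_gt0.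
- exact: L1Z.
move=> kl; rewrite L1distZ// ?T1// ?mulr_gt0//.
rewrite gtr0_norm// [leRHS]EFinM lee_wpmul2l ?lee_fin ?(ltW delta0)// fe//.
by rewrite mulr_gt0//= ler_pM2r// ler_nat.
Qed.

Lemma L1_riemann_sum f N n : L1 mu D f -> 0 <= N -> L1 mu D (riemann_sum T f N n).
Proof.
move=> f1; rewrite le_eqVlt => /predU1P[<-|N0]; last by apply: L1_step_sum; rewrite ?divr_gt0.
rewrite (_ : riemann_sum _ _ _ _ = cst 0); first exact: L1_0.
by apply/funext => x; rewrite /riemann_sum big1// => k _; rewrite !mul0r.
Qed.

(** The sums are Cauchy: those with [m.+1] and [n.+1] steps are both close to their common
    refinement with [m.+1 * n.+1] steps. *)
Lemma riemann_sum_cvg f N : L1 mu D f -> 0 <= N ->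
  exists2 g, L1 mu D g & L1cvg mu D (riemann_sum T f N) g.
Proof.
move=> f1 N0; apply: L1_complete => // [k|e e0]; first exact: L1_riemann_sum.
move: N0; rewrite le_eqVlt => /predU1P[<-|N0].
  exists 0%N => m n _ _; rewrite /riemann_sum.
  under eq_fun do under eq_bigr do rewrite !mul0r.
  under [X in L1dist _ _ _ X]eq_fun do under eq_bigr do rewrite !mul0r.
  by rewrite !sumr_const !mul0rn L1distxx lee_fin ltW.
(* The refinement error is the total length [N] times the modulus, which is thus taken to be
   [e / 2 / N]. *)
have e'0 : 0 < e / 2 / N by rewrite !divr_gt0.
have [eta eta0 fe] := semigroup_small_time f1 e'0.
have [n0 _ n0P] := near_infty_natSinv_lt (PosNum (divr_gt0 eta0 N0)).
have stepP n : (n0 <= n)%N -> N / n.+1%:R <= eta.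
  by move=> /n0P /=; rewrite ltr_pdivlMr// mulrC => /ltW.
have refine n m : (n0 <= n)%N -> (L1dist mu D (riemann_sum T f N n)
    (step_sum f (N / n.+1%:R / m.+1%:R) (n.+1 * m.+1)) <= (e / 2)%:E)%E.
  move=> n0n; have -> : e / 2 = n.+1%:R * (N / n.+1%:R) * (e / 2 / N).
    by field; rewrite !gt_eqF.
  apply: step_sum_refine => //; [by rewrite divr_gt0|exact: ltW|].
  by move=> t /andP[t0 tN]; apply: fe; rewrite t0 (le_trans tN)// stepP.
exists n0 => m n n0m n0n; rewrite [e]splitr EFinD.
pose w := step_sum f (N / m.+1%:R / n.+1%:R) (m.+1 * n.+1).
have wE : w = step_sum f (N / n.+1%:R / m.+1%:R) (n.+1 * m.+1).
  by rewrite /w mulnC mulrAC.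
apply: le_trans (L1dist_triangle mD _ (_ : L1 mu D w) _) _.
- by apply: L1_riemann_sum => //; exact: ltW.
- by apply: L1_step_sum; rewrite ?divr_gt0.
- by apply: L1_riemann_sum => //; exact: ltW.
by apply: leeD; [exact: refine|rewrite L1distC wE; exact: refine].
Qed.

(** Since a limit exists, [xget] returns a limit and not its default value. *)
Lemma time_integralP f N : L1 mu D f -> 0 <= N ->
  L1 mu D (time_integral mu D T f N) /\
  L1cvg mu D (riemann_sum T f N) (time_integral mu D T f N).
Proof.
move=> f1 N0; have [g g1 fg] := riemann_sum_cvg f1 N0.
exact: (xgetPex (cst 0) (P := [set g | L1 mu D g /\ L1cvg mu D (riemann_sum T f N) g])
  (ex_intro _ g (conj g1 fg))).
Qed.

(** These sums form a subsequence of the Riemann sums over the horizon [p%:R * N]. Their mesh does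
    not depend on [p], so different horizons can be compared term by term. *)
Lemma step_sum_cvg f (p : nat) N : L1 mu D f -> 0 < N ->
  L1cvg mu D (fun l => step_sum f (N / l.+1%:R) (p * l.+1))
    (time_integral mu D T f (p%:R * N)).
Proof.
move=> f1 N0; have pN0 : 0 <= p%:R * N by rewrite mulr_ge0// ltW.
have [_ /L1cvgP f_cvg] := time_integralP f1 pN0; apply/L1cvgP => e e0.
have [n0 _ n0P] := f_cvg _ e0; exists n0 => // l /= n0l.
(* For [p = 0] the index [(p * l.+1).-1] would not give an empty sum; there both sums vanish
   directly. *)
case: p pN0 {f_cvg} n0P => [|p] pN0 n0P.
  move: (n0P l n0l); rewrite (_ : riemann_sum _ _ _ _ = cst 0); last first.
    by apply/funext => x; rewrite /riemann_sum big1// => k _; rewrite !mul0r.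
  rewrite (_ : step_sum _ _ _ = cst 0)//.
  by apply/funext => x; rewrite /step_sum mul0n big_ord0.
have := n0P (p.+1 * l.+1).-1; rewrite /riemann_sum /step_sum prednK ?muln_gt0//.
have -> : p.+1%:R * N / (p.+1 * l.+1)%:R = N / l.+1%:R.
  by rewrite natrM; field; rewrite !gt_eqF// ltr0n.
by apply; rewrite /= (leq_trans n0l)// leq_addr.
Qed.

End semigroup.

(** * The extension of the semigroup to the constant 1 *)

Section extension_of_one.
Context {R : realType} {d : nat} {mu : {measure set 'rV[R]_d -> \bar R}}.
Context {D : set 'rV[R]_d} (T : R -> ('rV[R]_d -> R) -> 'rV[R]_d -> R).
Hypotheses (mD : measurable D) (TC0 : C0_semigroup mu D T).
Variable fn : nat -> 'rV[R]_d -> R.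
Hypothesis fn_approx : increasing_approx mu D fn (cst 1).
Implicit Types (f g h : 'rV[R]_d -> R) (r s t : R).

Let fn1 n : L1 mu D (fn n). Proof. by case: fn_approx => /(_ n)[]. Qed.

Lemma increasing_approx1 : {ae mu, forall x, D x ->
  [/\ forall n, 0 <= fn n x <= 1, nondecreasing_seq (fn ^~ x) &
      fn n x @[n --> \oo] --> (1 : R)]}.
Proof.
case: fn_approx => _; apply: filterS => x /[apply] -[fnx fnx1].
have fn_nd : nondecreasing_seq (fn ^~ x).
  by apply/nondecreasing_seqP => n; case/andP: (fnx n).
split=> // n; case/andP: (fnx n) => -> _ /=.
have {}fnx1 : fn n x @[n --> \oo] --> (1 : R) := fnx1.
rewrite -(cvg_lim _ fnx1)//; apply: nondecreasing_cvgn_le => //.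
by apply/cvg_ex; exists 1.
Qed.

Let fn_ae := increasing_approx1.

Let fn01 n : {ae mu, forall x, D x -> 0 <= fn n x <= 1}.
Proof. by apply: filterS fn_ae => x /[apply] -[]. Qed.

(* The extension of T_t to 1, T_t 1 = lim_n T_t fn; the limsup only makes it
   measurable off the null set where the sequence may fail to converge. *)
Definition ext1 t : 'rV[R]_d -> R := fun x => fine (limn_esup (fun n => (T t (fn n) x)%:E)).

Lemma measurable_ext1 t : 0 < t -> measurable_fun D (ext1 t).
Proof.
move=> t0; apply: (measurableT_comp (@fine_measurable _ setT _)) => //.
apply: measurable_fun_limn_esup => n; apply/measurable_EFinP.
exact: L1_measurable (semigroup_L1 TC0 t0 (fn1 n)).
Qed.

(** Almost everywhere, [T t (fn n)] is a nondecreasing sequence in [0, 1], hence converges to its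
    supremum. *)
Lemma ext1P t : 0 < t -> {ae mu, forall x, D x ->
  [/\ T t (fn n) x @[n --> \oo] --> ext1 t x, forall n, T t (fn n) x <= ext1 t x &
      0 <= ext1 t x <= 1]}.
Proof.
move=> t0.
have T01 : {ae mu, forall x n, D x -> 0 <= T t (fn n) x <= 1}.
  by apply: ae_foralln => n; exact (semigroup_submarkov TC0 t0 (fn1 n) (fn01 n)).
have T_nd : {ae mu, forall x n, D x -> T t (fn n) x <= T t (fn n.+1) x}.
  apply: ae_foralln => n; apply: semigroup_homo => //.
  apply: filterS fn_ae => x /[apply] -[f01 f_nd _].
  have := f_nd n n.+1 (leqnSn n); have := f01 n; have := f01 n.+1; lra.
apply: filterS2 T01 T_nd => x T01 T_nd Dx.
have {}T_nd : nondecreasing_seq (fun n => T t (fn n) x).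
  by apply/nondecreasing_seqP => n; exact: T_nd.
have Tcvg : cvgn (fun n => T t (fn n) x).
  apply: nondecreasing_is_cvgn => //; exists 1 => _ [n _ <-].
  by case/andP: (T01 n Dx).
have -> : ext1 t x = limn (fun n => T t (fn n) x).
  have /cvg_limn_einf_sup[_] : (T t (fn n) x)%:E @[n --> \oo] -->
      (limn (fun n => T t (fn n) x))%:E.
    by apply: cvg_EFin; [exact: nearW|exact: Tcvg].
  by rewrite /ext1 => ->.
split=> //; first by move=> n; exact: nondecreasing_cvgn_le.
apply/andP; split.
  by apply: limr_ge => //; apply: nearW => n; case/andP: (T01 n Dx).
by apply: limr_le => //; apply: nearW => n; case/andP: (T01 n Dx).
Qed.

(** The truncations [Num.min (g x) (fn n x)] tend to [g] in [L^1], and lie below [fn n] by at most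
    1, as [semigroup_homo] demands. *)
Lemma semigroup_le_ext1 t g : 0 < t -> L1 mu D g ->
  {ae mu, forall x, D x -> 0 <= g x <= 1} ->
  {ae mu, forall x, D x -> T t g x <= ext1 t x}.
Proof.
move=> t0 g1 g01; pose v n x := Num.min (g x) (fn n x).
have v1 n : L1 mu D (v n) by exact: L1_min.
have T1 h : L1 mu D h -> L1 mu D (T t h) by exact: (semigroup_L1 TC0 t0).
have vg : L1cvg mu D v g.
  have mE h : L1 mu D h -> measurable_fun D (EFin \o h) by exact: measurable_int.
  have v_g : {ae mu, forall x, D x -> (EFin \o v n) x @[n --> \oo] --> (EFin \o g) x}.
    apply: filterS2 g01 fn_ae => x + + Dx => /(_ Dx) /andP[g0 g_le1] /(_ Dx)[fn01x _ fnx].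
    apply: cvg_EFin; first exact: nearW.
    (* As [g] and [fn n] are at most 1, their minimum is at least [fn n + g - 1]. *)
    apply: (@squeeze_cvgr _ _ _ _ (fun n => fn n x + (g x - 1)) (cst (g x))).
    - apply: nearW => n; have /andP[_ f_le1] := fn01x n.
      by rewrite /v /=; case: (leP (g x) (fn n x)) => gf; lra.
    - suff : fn n x + (g x - 1) @[n --> \oo] --> 1 + (g x - 1) by rewrite (addrC 1) subrK.
      by apply: cvgD => //; exact: cvg_cst.
    - exact: cvg_cst.
  have v_le : {ae mu, forall x n, D x -> (`|(EFin \o v n) x| <= (abse \o (EFin \o g)) x)%E}.
    apply: filterS2 g01 fn_ae => x + + n Dx => /(_ Dx) /andP[g0 g_le1] /(_ Dx)[fn01x _ _].
    have /andP[f0 _] := fn01x n.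
    rewrite /= lee_fin (ger0_norm g0) ger0_norm; first by rewrite ge_min lexx.
    by rewrite le_min g0.
  by have [_ vg _] := dominated_convergence mD (fun n => mE _ (v1 n)) (mE _ g1) v_g
    (integrable_abse g1) v_le.
apply: (L1_order_closed mD (fun n => T1 _ (v1 n)) (T1 _ g1)).
  apply/L1cvgP => e e0; move/L1cvgP : vg => /(_ _ e0); apply: filterS => n.
  by apply: le_trans; exact: semigroup_L1dist.
move=> n; have : {ae mu, forall x, D x -> T t (v n) x <= T t (fn n) x}.
  apply: semigroup_homo => //.
  apply: filterS2 g01 fn_ae => x + + Dx => /(_ Dx) gx /(_ Dx)[/(_ n) fx _ _].
  rewrite /v; case: (leP (g x) (fn n x)) => gfn; lra.
apply: filterS2 (ext1P t0) => x + + Dx => /(_ Dx)[_ /(_ n) Tp _] /(_ Dx) vfn.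
exact: le_trans Tp.
Qed.

(* Apply T_t to f + T_s fn <= 1 and let n tend to infinity. *)
Lemma ext1_decrease s t f : 0 < s -> 0 < t -> L1 mu D f ->
  {ae mu, forall x, D x -> 0 <= f x <= 1 - ext1 s x} ->
  {ae mu, forall x, D x -> T t f x <= ext1 t x - ext1 (t + s) x}.
Proof.
move=> s0 t0 f1 f_le; have ts0 : 0 < t + s by rewrite addr_gt0.
have Ts1 n : L1 mu D (T s (fn n)) by exact: (semigroup_L1 TC0).
have Tle n : {ae mu, forall x, D x -> T t f x + T (t + s) (fn n) x <= ext1 t x}.
  have fT01 : {ae mu, forall x, D x -> 0 <= f x + T s (fn n) x <= 1}.
    apply: filterS3 f_le (ext1P s0) (semigroup_submarkov TC0 s0 (fn1 n) (fn01 n)).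
    move=> x + + + Dx => /(_ Dx) + /(_ Dx)[_ /(_ n) + _] /(_ Dx); lra.
  apply: filterS3 (semigroup_le_ext1 t0 (L1D mD f1 (Ts1 n)) fT01)
    (semigroup_addf TC0 t0 f1 (Ts1 n)) (semigroup_add TC0 t0 s0 (fn1 n)).
  by move=> x + + + Dx => /(_ Dx) + /(_ Dx) TE /(_ Dx) ->; rewrite TE.
apply: filterS2 (ext1P ts0) (ae_foralln Tle) => x + + Dx => /(_ Dx)[Tcvg _ _] Tfle.
rewrite lerBrDr -lerBrDl -(cvg_lim _ Tcvg)//; apply: limr_le.
  by apply/cvg_ex; exists (ext1 (t + s) x).
by apply: nearW => n; rewrite lerBrDl; exact: Tfle.
Qed.

(** A time shift by [m] is exactly [m * l] steps of mesh [l%:R^-1]. After [ext1_decrease],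
    telescoping leaves at most [m * l] values bounded by 1, whose weighted sum is at most [m]
    whatever [q] is. *)
Lemma step_sum_le f (m l q : nat) : (0 < m)%N -> (0 < l)%N -> L1 mu D f ->
  {ae mu, forall x, D x -> 0 <= f x <= 1 - ext1 m%:R x} ->
  {ae mu, forall x, D x -> step_sum T f l%:R^-1 q x <= m%:R}.
Proof.
move=> m0 l0 f1 f_le; pose delta : R := l%:R^-1.
have delta0 : 0 < delta by rewrite invr_gt0 ltr0n.
have td0 k : 0 < k.+1%:R * delta by rewrite mulr_gt0.
have m0' : 0 < m%:R :> R by rewrite ltr0n.
have Tle := ae_foralln (fun k => ext1_decrease m0' (td0 k) f1 f_le).
have p01 := ae_foralln (fun k => ext1P (td0 k)).
apply: filterS2 Tle p01 => x Tle p01 Dx.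
have mE : m%:R = (m * l)%:R * delta by rewrite natrM mulfK// pnatr_eq0 -lt0n.
apply: (@le_trans _ _ (\sum_(k < q) delta *
    (ext1 (k.+1%:R * delta) x - ext1 ((k + m * l).+1%:R * delta) x))).
  apply: ler_sum => k _; rewrite ler_pM2l// (le_trans (Tle k Dx))//.
  by rewrite {1}mE -mulrDl -natrD addSn.
rewrite -mulr_sumr mE mulrC ler_pM2r//.
apply: (@sum_shift_le R (fun k => ext1 (k.+1%:R * delta) x)) => k.
by have [] := p01 k Dx.
Qed.

(** This is [ext1_decrease] for [f = 0], combined with the positivity of [T t (cst 0)]. *)
Lemma ext1_antitone s t : 0 < s -> 0 < t ->
  {ae mu, forall x, D x -> ext1 (t + s) x <= ext1 t x}.
Proof.
move=> s0 t0; have := ext1_decrease s0 t0 (@L1_0 _ _ mu D).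
have /[swap]/[apply] : {ae mu, forall x, D x -> 0 <= (cst 0 x : R) <= 1 - ext1 s x}.
  by apply: filterS (ext1P s0) => x /[apply] -[_ _]; rewrite /=; lra.
have T0 : {ae mu, forall x, D x -> 0 <= T t (cst 0) x <= 1}.
  by apply: (semigroup_submarkov TC0 t0 L1_0); apply: aeW => x _ /=; rewrite lexx ler01.
apply: filterS2 T0 => x + + Dx => /(_ Dx) + /(_ Dx); lra.
Qed.

End extension_of_one.

(** * From recurrence to conservativeness *)

Section recurrence.
Context {R : realType} {d : nat} {mu : {measure set 'rV[R]_d -> \bar R}}.
Context {D : set 'rV[R]_d} (T : R -> ('rV[R]_d -> R) -> 'rV[R]_d -> R).
Hypotheses (mD : measurable D) (TC0 : C0_semigroup mu D T).
Implicit Types (f g h : 'rV[R]_d -> R) (r s t N : R).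

(** At a common mesh, the step sum for [q] extends the one for [p] by nonnegative terms; the order
    is preserved in the limit. *)
Lemma time_integral_homo f (p q : nat) N : L1 mu D f ->
  {ae mu, forall x, D x -> 0 <= f x <= 1} -> 0 < N -> (p <= q)%N ->
  {ae mu, forall x, D x ->
    time_integral mu D T f (p%:R * N) x <= time_integral mu D T f (q%:R * N) x}.
Proof.
move=> f1 f01 N0 pq.
have TI1 k : L1 mu D (time_integral mu D T f (k%:R * N)).
  by have [] := time_integralP mD TC0 f1 (mulr_ge0 (ler0n R k) (ltW N0)).
have delta0 l : 0 < N / l.+1%:R by rewrite divr_gt0.
have S1 k l : L1 mu D (step_sum T f (N / l.+1%:R) k) by exact: L1_step_sum.
have S_cvg k := step_sum_cvg mD TC0 k f1 N0.
suff : {ae mu, forall x, D x ->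
    time_integral mu D T f (p%:R * N) x - time_integral mu D T f (q%:R * N) x <= cst 0 x}.
  by apply: filterS => x /[apply]; rewrite subr_le0.
apply: (L1_order_closed mD (v := fun l x => step_sum T f (N / l.+1%:R) (p * l.+1) x
  - step_sum T f (N / l.+1%:R) (q * l.+1) x)) => [l|||l]; [exact: L1B|exact: L1B|exact: L1cvgB|].
have T0 : {ae mu, forall x k, D x -> 0 <= T (k.+1%:R * (N / l.+1%:R)) f x <= 1}.
  apply: ae_foralln => k; have kd0 : 0 < k.+1%:R * (N / l.+1%:R) by rewrite mulr_gt0.
  exact (semigroup_submarkov TC0 kd0 f1 f01).
apply: filterS T0 => x T0 Dx; rewrite subr_le0 /step_sum.
rewrite -!(big_mkord xpredT (fun k => N / l.+1%:R * T (k.+1%:R * (N / l.+1%:R)) f x)).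
rewrite [leRHS](@big_cat_nat _ _ _ (p * l.+1)%N) ?leq_mul2r ?pq ?orbT//= lerDl.
by apply: sumr_ge0 => k _; rewrite mulr_ge0 ?(ltW (delta0 l))//; case/andP: (T0 k Dx).
Qed.

(** Time averages over short intervals are close to [f], by strong continuity at 0. *)
Lemma time_integral_small_time f e : L1 mu D f -> 0 < e -> exists2 eta : R, 0 < eta &
  forall N, 0 < N <= eta ->
    (L1dist mu D (time_integral mu D T f N) (fun x => N * f x)%R <= (N * e)%:E)%E.
Proof.
move=> f1 e0; have e20 : 0 < e / 2 by rewrite divr_gt0.
have [eta eta0 fe] := semigroup_small_time TC0 f1 e20; exists eta => // N /andP[N0 Neta].
have [TI1 /L1cvgP RTI] := time_integralP mD TC0 f1 (ltW N0).
(* A single Riemann sum within [N * (e / 2)] of the integral suffices; its nodes all lie in the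
   small interval. *)
have [n _ /(_ n (leqnn n)) /= nP] := RTI _ (mulr_gt0 N0 e20).
have R1 := L1_riemann_sum mD TC0 n f1 (ltW N0).
apply: le_trans (L1dist_triangle mD TI1 R1 (L1Z mD N f1)) _.
rewrite [e]splitr mulrDr EFinD L1distC leeD//.
have NE : N = n.+1%:R * (N / n.+1%:R) by rewrite mulrC divfK.
rewrite [X in L1dist _ _ _ X](_ : _ = (fun x => n.+1%:R * (N / n.+1%:R) * f x)); last first.
  by apply/funext => x; rewrite -NE.
rewrite [in leRHS]NE; apply: (step_sum_small_time mD TC0) => //; first by rewrite divr_gt0.
  exact: ltW.
by rewrite -NE => t /andP[t0 tN]; apply: fe; rewrite t0 (le_trans tN).
Qed.

(** The integrals up to time [j.+1%:R^-1] are dominated by the one up to time 1, hence nonpositive;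
    multiplied by [j.+1] they tend to [f] in [L^1]. *)
Lemma time_integral_le0 f : L1 mu D f -> {ae mu, forall x, D x -> 0 <= f x <= 1} ->
  {ae mu, forall x, D x -> time_integral mu D T f 1 x <= 0} ->
  {ae mu, forall x, D x -> f x <= 0}.
Proof.
move=> f1 f01 TI0; pose N j : R := j.+1%:R^-1.
have N0 j : 0 < N j by rewrite invr_gt0.
have TI1 j : L1 mu D (time_integral mu D T f (N j)).
  by have [] := time_integralP mD TC0 f1 (ltW (N0 j)).
apply: (L1_order_closed mD (h := cst 0)
  (v := fun j x => j.+1%:R * time_integral mu D T f (N j) x)) => [j|//||j].
- exact: L1Z.
- apply/L1cvgP => e e0; have [eta eta0 fe] := time_integral_small_time f1 e0.
  have [n0 _ n0P] := near_infty_natSinv_lt (PosNum eta0); exists n0 => // j /= n0j.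
  have := fe (N j); rewrite N0 ltW ?n0P// => /(_ isT).
  rewrite -(@lee_pmul2l _ j.+1%:R%:E)// -EFinM mulrA divff// mul1r.
  apply: le_trans; rewrite -[X in (X%:E * _)%E]gtr0_norm// -L1distZ//; last exact: L1Z.
  rewrite [X in (_ <= L1dist _ _ _ X)%E](_ : _ = f)//.
  by apply/funext => x; rewrite mulrA divff// mul1r.
have := @time_integral_homo f 1 j.+1 (N j) f1 f01 (N0 j) isT.
rewrite mul1r divff//; apply: filterS2 TI0 => x + + Dx => /(_ Dx) TI0 /(_ Dx) TIj.
by rewrite /= pmulr_rle0// (le_trans TIj).
Qed.

(** The potential is at most [M], so recurrence makes it 0; it dominates the integral up to time
    1. *)
Lemma bounded_potential_le0 f (M : R) : recurrent mu D T -> L1 mu D f ->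
  {ae mu, forall x, D x -> 0 <= f x <= 1} ->
  (forall n : nat, {ae mu, forall x, D x -> time_integral mu D T f n%:R x <= M}) ->
  {ae mu, forall x, D x -> f x <= 0}.
Proof.
move=> Trec f1 f01 TIM; apply: time_integral_le0 => //.
have f0 : {ae mu, forall x, D x -> 0 <= f x} by apply: filterS f01 => x /[apply] /andP[].
have TI_nd : {ae mu, forall x n, D x ->
    time_integral mu D T f n%:R x <= time_integral mu D T f n.+1%:R x}.
  apply: ae_foralln => n; have := @time_integral_homo f n n.+1 1 f1 f01 ltr01 (leqnSn n).
  by rewrite !mulr1.
apply: filterS3 (Trec f f1 f0) TI_nd (ae_foralln TIM) => x + TI_nd {}TIM Dx => /(_ Dx).
have nd : nondecreasing_seq (fun n : nat => (time_integral mu D T f n%:R x)%:E).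
  by apply/nondecreasing_seqP => n; rewrite lee_fin TI_nd.
have TIcvg := ereal_nondecreasing_is_cvgn nd.
have TIM' : (potential mu D T f x <= M%:E)%E.
  by apply: lime_le => //; apply: nearW => n; rewrite lee_fin TIM.
case=> [pot0|poty]; last by rewrite poty in TIM'.
rewrite -lee_fin (@le_trans _ _ (potential mu D T f x))//; last by rewrite pot0.
rewrite /potential (cvg_lim _ (ereal_nondecreasing_cvgn nd))//.
by apply: ereal_sup_ubound; exists 1%N.
Qed.

Lemma recurrent_ext1 fn (m : nat) : increasing_approx mu D fn (cst 1) -> recurrent mu D T ->
  (0 < m)%N -> {ae mu, forall x, D x -> ext1 T fn m%:R x = 1}.
Proof.
move=> fnP Trec m0; have m0' : 0 < m%:R :> R by rewrite ltr0n.
have p01 := ext1P mD TC0 fnP m0'; have fn01 := increasing_approx1 fnP.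
(* The factor [fn n] makes the function integrable, keeps it below [1 - ext1 T fn m%:R], and tends
   to 1. *)
pose f n x := (1 - ext1 T fn m%:R x) * fn n x.
have f01 n : {ae mu, forall x, D x -> 0 <= f n x <= 1 - ext1 T fn m%:R x}.
  apply: filterS2 p01 fn01 => x + + Dx => /(_ Dx)[_ _ p01x] /(_ Dx)[/(_ n) fnx _ _].
  by rewrite /f; nra.
have f1 n : L1 mu D (f n).
  have fn1 : L1 mu D (fn n) by case: fnP => /(_ n)[].
  apply: (le_L1 mD _ _ fn1).
    apply: measurable_funM; last exact: (L1_measurable fn1).
    by apply: measurable_funB => //; exact: (measurable_ext1 TC0 fnP).
  apply: filterS2 p01 fn01 => x + + Dx => /(_ Dx)[_ _ p01x] /(_ Dx)[/(_ n) fnx _ _].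
  rewrite normrM ler_piMl// ger0_norm; lra.
have f_le0 n : {ae mu, forall x, D x -> f n x <= 0}.
  apply: (@bounded_potential_le0 _ m%:R) => //.
    by apply: filterS2 p01 (f01 n) => x + + Dx => /(_ Dx)[_ _ +] /(_ Dx); lra.
  move=> k; have [TI1 _] := time_integralP mD TC0 (f1 n) (ler0n R k).
  (* With unit [N = 1] the mesh is [l.+1%:R^-1], which divides [m] as [step_sum_le] requires. *)
  have := step_sum_cvg mD TC0 k (f1 n) ltr01; rewrite mulr1 => S_cvg.
  apply: (L1_order_closed mD (h := cst m%:R) _ TI1 S_cvg) => l.
    by apply: L1_step_sum => //; rewrite divr_gt0.
  by rewrite div1r; exact (step_sum_le mD TC0 fnP (k * l.+1)%N m0 (ltn0Sn l) (f1 n) (f01 n)).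
apply: filterS3 p01 fn01 (ae_foralln f_le0) => x + + f_le0x Dx.
move=> /(_ Dx)[_ _ /andP[_ p_le1]] /(_ Dx)[_ _ fnx].
apply/eqP; rewrite eq_le p_le1 /= -subr_le0.
have fx : f n x @[n --> \oo] --> 1 - ext1 T fn m%:R x.
  by rewrite -[X in _ --> X]mulr1; apply: cvgM => //; exact: cvg_cst.
rewrite -(cvg_lim _ fx)//; apply: limr_le; first by apply/cvg_ex; eexists; exact: fx.
by apply: nearW => n; exact: f_le0x.
Qed.

(** Indicators of an increasing cover of [D] by sets of finite measure. *)
Lemma sigma_finite_increasing_approx : sigma_finite D mu ->
  exists fn, increasing_approx mu D fn (cst 1).
Proof.
move=> /sigma_finiteP[F [DF ndF mF]]; exists (fun n => \1_(F n)); split.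
  move=> n; have [mFn Fn_fin] := mF n; split; last first.
    exists 1; apply: aeW => x _; rewrite indicE; case: (_ \in _) => /=.
      by rewrite normr1.
    by rewrite normr0.
  apply/integrableP; split; first by apply/measurable_EFinP; exact: measurable_indic.
  under eq_integral do rewrite gee0_abs ?lee_fin//.
  by rewrite integral_indic// (le_lt_trans _ Fn_fin)// le_measure// inE//; exact: measurableI.
apply: aeW => x; rewrite DF => -[n0 _ Fn0x]; split.
  move=> n; rewrite !indicE ler0n ler_nat /=; case: (boolP (x \in F n)) => // /set_mem Fnx.
  by rewrite mem_set//; move/subsetPset : (ndF _ _ (leqnSn n)); apply.
apply: cvg_near_cst; exists n0 => // n /= n0n.
by rewrite indicE mem_set//; move/subsetPset : (ndF _ _ n0n); apply.
Qed.

(** For an integer [m > t], monotonicity in time gives [1 = ext1 m <= ext1 t <= 1], so [T t (fn n)]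
    tends to 1. *)
Theorem recurrent_conservative : sigma_finite D mu -> recurrent mu D T -> conservative mu D T.
Proof.
move=> Dfin Trec t t0; split; first exact: sigma_finite_increasing_approx.
move=> fn fnP; have [m tm] : exists m : nat, t < m%:R.
  by exists (Num.bound t); exact: archi_boundP (ltW t0).
have m0 : (0 < m)%N by rewrite -(ltr0n R) (lt_trans t0).
have mt0 : 0 < m%:R - t by rewrite subr_gt0.
apply: filterS3 (recurrent_ext1 fnP Trec m0) (ext1P mD TC0 fnP t0)
  (ext1_antitone mD TC0 fnP mt0 t0).
move=> x + + + Dx => /(_ Dx) pm /(_ Dx)[Tcvg _ /andP[_ pt_le1]] /(_ Dx).
rewrite addrC subrK pm => pt_ge1.
by rewrite (_ : cst 1 x = ext1 T fn t x)//; apply/le_anti; rewrite pt_ge1.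
Qed.

End recurrence.

(** * Application to the semigroup of the setting *)

Theorem corollary20 (R : realType) (d : nat) (E : set 'rV[R]_d)
    (phi : 'rV[R]_d -> R) (mu : {measure set 'rV[R]_d -> \bar R})
    (A : 'rV[R]_d -> 'M[R]_d) (B : 'rV[R]_d -> 'rV[R]_d)
    (T : R -> ('rV[R]_d -> R) -> ('rV[R]_d -> R))
  (hE : open E \/ closed E)
  (hbd : closed E -> lebesgue_rV d (closure E `\` interior E) = 0%E)
  (hphi : L1loc (lebesgue_rV d) E phi)
  (hphi_gt0 : {ae lebesgue_rV d, forall x, E x -> 0 < phi x})
  (hmu : forall S, measurable S ->
    mu S = (\int[lebesgue_rV d]_(x in S `&` E) (phi x)%:E)%E)
  (hsf : sigma_finite E mu)
  (hsupp : forall U : set 'rV[R]_d, open U -> E `&` U !=set0 ->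
    (0 < mu (E `&` U))%E)
  (hA : forall i j, L1loc mu E (fun x => A x i j))
  (hell : forall V, relcompact E V -> exists2 nu : R, 0 < nu &
    forall (xi : 'rV[R]_d) (x : 'rV[R]_d), V x ->
      nu^-1 * dotv xi xi <=
        \sum_i \sum_j 2^-1 * (A x i j + A x j i) * xi ord0 i * xi ord0 j
      <= nu * dotv xi xi)
  (hclos : closable_form mu E A)
  (hsect : strong_sector mu E A)
  (hB : forall i, L2loc mu E (fun x => B x ord0 i))
  (hBdiv : forall f, C0inf E f -> \int[mu]_(x in E) dotv (B x) (grad f x) = 0)
  (hdense : domL0_0b_dense mu E A)
  (hT : is_Tbar mu E A B T) :
  recurrent mu E T -> conservative mu E T.
Proof.
have [_ [_ [_ _ _ TC0 _]]] := hT.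
(* Sigma-finiteness presents [E] as a countable union of measurable sets. *)
have mE : measurable E.
  by have [F -> mF] := hsf; apply: bigcupT_measurable => n; case: (mF n).
exact: recurrent_conservative.
Qed.
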